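(* For every integer $d\geq 5$, the sign pattern $\Sigma_{1,d-2,1,1}$ (of length $d+1$) is canonical.
   Context: All polynomials are real, univariate, monic, with all coefficients nonvanishing. Such a polynomial is a hyperbolic polynomial (HP) if all its roots are real. A sign pattern (SP) of length $d+1$ is a sequence of $d+1$ signs $+$ or $-$ beginning with $+$. The SP of $P=\sum_{j=0}^d a_jx^j$ ($a_d=1$, all $a_j\in\mathbb{R}\setminus\{0\}$) is $\sigma(P)=(+,\mathrm{sgn}(a_{d-1}),\ldots,\mathrm{sgn}(a_0))$; we say that $P$ realizes $\sigma(P)$. By Descartes' rule of signs, an HP has exactly as many positive (resp. negative) roots, counted with multiplicity, as there are sign changes (resp. sign preservations) between consecutive signs of $\sigma(P)$. For positive integers $m_1,\ldots,m_s$ with $m_1+\cdots+m_s=d+1$, $\Sigma_{m_1,\ldots,m_s}$ denotes the SP consisting of $m_1$ signs $+$, followed by $m_2$ signs $-$, followed by $m_3$ signs $+$, etc. (The paper also writes $\Sigma_{[1],d-2,[2]}$ for $\Sigma_{1,d-2,1,1}$, where $[k]$ stands for a maximal sequence of $k$ consecutive components equal to $1$.) Change-preservation pattern (CPP): to an SP of length $d+1$ one associates the word of length $d$ in the letters $c,p$ whose $j$-th letter ($1\le j\le d$) is $p$ if the signs in positions $j$ and $j+1$ of the SP are equal and $c$ if they are different. Canonical order: read the CPP of $\sigma$ from right to left and replace each $p$ by $N$ and each $c$ by $P$, obtaining a word $(w_1,\ldots,w_d)$. An HP realizing $\sigma$ whose roots have pairwise distinct moduli $0<\gamma_1<\cdots<\gamma_d$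 has canonical order of the moduli of its roots if, for each $i$, the root of modulus $\gamma_i$ is positive when $w_i=P$ and negative when $w_i=N$. An SP $\sigma$ is canonical if every HP that realizes $\sigma$ and whose roots have pairwise distinct moduli has canonical order of the moduli of its roots. *)

(* Defs.v *)
(* R : realType is the field of real numbers, R[i] the complex numbers over it. *)
From HB Require Import structures.
From mathcomp Require Import all_boot all_order all_algebra.
From mathcomp Require Import reals.
From mathcomp Require Import complex.

Set Implicit Arguments.
Unset Strict Implicit.
Unset Printing Implicit Defensive.

Import Order.TTheory GRing.Theory Num.Theory.

Local Open Scope ring_scope.

(* Monic with all coefficients nonvanishing: the standing assumption on
   polynomials. *)
Definition admissible (R : realType) (P : {poly R}) : Prop :=
  P \is monic /\ forall i, (i < size P)%N -> P`_i != 0.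

Definition hyperbolic (R : realType) (P : {poly R}) : Prop :=
  admissible P /\
  forall z : R[i],
    root (map_poly (real_complex R) P) z -> exists x : R, z = real_complex R x.

(* Signs are the integers 1 and -1. A polynomial is stored by increasing degree
   whereas a sign pattern starts with the leading coefficient, hence rev. *)
Definition sign_pattern (R : realType) (P : {poly R}) : seq int :=
  [seq sgz a | a <- rev P].

Definition realizes (R : realType) (P : {poly R}) (sigma : seq int) : Prop :=
  sign_pattern P = sigma.

Fixpoint alternating_blocks (s : int) (ms : seq nat) : seq int :=
  if ms is m :: ms' then nseq m s ++ alternating_blocks (- s) ms' else [::].

Definition Sigma (ms : seq nat) : seq int := alternating_blocks 1 ms.

Variant cp_letter := Change | Preservation.

Definition cpp (sigma : seq int) : seq cp_letter :=
  if sigma is s :: sigma' then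
    pairmap (fun x y => if x == y then Preservation else Change) s sigma'
  else [::].

Variant pn_letter := Pos | Neg.

Definition canonical_word (sigma : seq int) : seq pn_letter :=
  [seq (if l is Preservation then Neg else Pos) | l <- rev (cpp sigma)].

(* rs lists the roots of the monic polynomial P, with multiplicity, by
   increasing modulus, and 0 < gamma_1 < ... < gamma_d for their moduli.
   Such an rs exists exactly when the roots of P are real, nonzero and of
   pairwise distinct moduli; it is then unique. *)
Definition roots_by_modulus (R : realType) (P : {poly R}) (rs : seq R) : Prop :=
  P = \prod_(z <- rs) ('X - z%:P) /\ path <%R 0 [seq `|z| | z <- rs].

Definition canonical_order (R : realType) (sigma : seq int) (rs : seq R) : Prop :=
  forall i, (i < size rs)%N ->
    match nth Neg (canonical_word sigma) i with
    | Pos => 0 < rs`_i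
    | Neg => rs`_i < 0
    end.

Definition canonical (R : realType) (sigma : seq int) : Prop :=
  forall (P : {poly R}) (rs : seq R),
    hyperbolic P -> realizes P sigma -> roots_by_modulus P rs ->
    canonical_order sigma rs.

(* Main.v *)
Require Import Defs.
From mathcomp Require Import all_boot all_order all_algebra.
From mathcomp Require Import reals.
From mathcomp Require Import polyrcf ring lra zify.

(** Write P for a polynomial realizing the pattern, with roots of distinct
moduli. Its signs say that the coefficients of degree 0, 1, 2 are negative,
positive, negative, that all coefficients from degree 2 to d - 1 are negative,
and hence that the sum of the roots is positive.

There are at most three positive roots: by Rolle's theorem four of them would
give two positive zeros of P'', which is impossible because all coefficients
of P'' but the leading one are negative ([no_four_pos_roots]).

Negative roots can be discarded. Dividing by X - z with z < 0 keeps the signs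
of the three lowest coefficients ([low_signs_cancel_neg]), and it increases
the sum of the roots. The hypothesis d >= 5 leaves at least two negative roots
next to the at most three positive ones, so that for each negative root there
is a divisor of P made of all the positive roots, this negative root and one
more, to which these four conditions pass. If there are not exactly three
positive roots, such a divisor violates the conditions on its low coefficients.
Otherwise it is a quintic Q with roots a < b < c, -u and -v
([quintic_neg_moduli]). Its even coefficients are all negative, so that
Q(x) + Q(-x) < 0 for every x > 0. At x = a, b, c this says that no positive
root separates u from v; at x = u it says that u < a or b < u < c. In
the first case both u and v are smaller than a, and the low coefficients,
read as inequalities between reciprocals of roots, exclude this
([reciprocal_ineq]). So b < u < c.

Hence each negative root has two positive roots below it in modulus and one
above it, and as there are only three positive roots this determines the order
([canonical_order_of_signs]). *)

Section SigmaCanonical.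

Import Order.TTheory GRing.Theory Num.Theory.
Local Open Scope ring_scope.
Set Implicit Arguments.
Unset Strict Implicit.
Unset Printing Implicit Defensive.

(** * Low coefficients and cancellation of negative roots *)

Definition low_signs (R : realType) (p : {poly R}) : Prop :=
  [/\ p`_0 < 0, 0 < p`_1 & p`_2 < 0].

Lemma coef0_XsubC_mul (R : realType) (c : R) (p : {poly R}) :
  (('X - c%:P) * p)`_0 = - (c * p`_0).
Proof. by rewrite mulrBl coefB coefXM coefCM sub0r. Qed.

Lemma coefS_XsubC_mul (R : realType) (c : R) (p : {poly R}) i :
  (('X - c%:P) * p)`_i.+1 = p`_i - c * p`_i.+1.
Proof. by rewrite mulrBl coefB coefXM coefCM. Qed.

(** With e = - z > 0 the coefficients of the product are e p_0, e p_1 + p_0 and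
e p_2 + p_1, so the signs of p_0, p_1, p_2 come out one after the other. *)
Lemma low_signs_cancel_neg (R : realType) (z : R) (p : {poly R}) :
  z < 0 -> low_signs (('X - z%:P) * p) -> low_signs p.
Proof.
rewrite /low_signs coef0_XsubC_mul !coefS_XsubC_mul => z0 [h0 h1 h2].
have k0 : p`_0 < 0 by nra.
have k1 : 0 < p`_1 by nra.
by split=> //; nra.
Qed.

Lemma low_signs_prod_cancel_neg (R : realType) (ns s : seq R) :
  all (< 0) ns -> low_signs (\prod_(z <- ns ++ s) ('X - z%:P)) ->
  low_signs (\prod_(z <- s) ('X - z%:P)).
Proof.
elim: ns => //= z ns IHns /andP[z0 ns0]; rewrite big_cons.
by move/(low_signs_cancel_neg z0); apply: IHns.
Qed.

(** With U = - u and V = - v, the signs of the coefficients of degree 1 and 2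
would give U V > c (U + V) and c > U + V, hence U V > (U + V)^2. *)
Lemma one_pos_two_neg_low_signs (R : realType) (c u v : R) :
  0 < c -> u < 0 -> v < 0 ->
  ~ low_signs (\prod_(z <- [:: u; v; c]) ('X - z%:P)).
Proof.
move=> c0 u0 v0; rewrite !big_cons big_nil /low_signs.
rewrite !(coef0_XsubC_mul, coefS_XsubC_mul, coef1) /= => -[_ h1 h2].
have uv : 0 < u * v by rewrite nmulr_rgt0.
have h1' : c * - (u + v) < u * v by nra.
have h2' : - (u + v) < c by nra.
have : - (u + v) * - (u + v) < c * - (u + v).
  by rewrite ltr_pM2r //; lra.
nra.
Qed.

(** * The quintic with two negative roots *)

(** Moving everything to one side leaves
(S - h) (S - k) < S^2 - (a b + a c + b c) with S = a + b + c.
Both factors on the left are positive and smaller than b + c, and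
(b + c)^2 is below the right-hand side because b c < a b. *)
Lemma reciprocal_ineq (R : realType) (a b c h k : R) :
  0 < c -> c < b -> b < a -> a < h -> a < k -> h + k < a + b + c ->
  h * k + (a * b + a * c + b * c) < (a + b + c) * (h + k).
Proof.
move=> c0 cb ba ah ak hk.
have : (a + b + c - h) * (a + b + c - k) < (b + c) * (b + c).
  by apply: ltr_pM; lra.
have : b * c < b * a by rewrite ltr_pM2l //; lra.
have : 0 < a * a by rewrite mulr_gt0 //; lra.
nra.
Qed.

(** The conclusion concerns u only, but u and v play symmetric roles. The
condition on the sum of the roots and the signs of the coefficients of degree 0
and 2 make the even part of the quintic negative; the coefficients of degree 1
and 2 exclude that u and v are both smaller than a. *)
Lemma quintic_neg_moduli (R : realType) (a b c u v : R) :
  0 < a -> a < b -> b < c -> 0 < u -> 0 < v ->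
  u + v < a + b + c ->
  low_signs (\prod_(z <- [:: - u; - v; a; b; c]) ('X - z%:P)) ->
  b < u < c.
Proof.
move=> a0 ab bc u0 v0 h4; rewrite !big_cons big_nil /low_signs.
rewrite !(coef0_XsubC_mul, coefS_XsubC_mul, coef1) /=.
rewrite !(mulr0, mulr1, subr0, oppr0, sub0r) => -[_ h1 h2].
have b0 : 0 < b by lra.
have c0 : 0 < c by lra.
have h1' : a * b * c * (u + v) < (a * b + a * c + b * c) * (u * v) by lra.
have h2' : (a * b + a * c + b * c) * (u + v) <
    (a + b + c) * (u * v) + a * b * c by lra.
(* The quintic Q satisfies Q(x) + Q(-x) < 0. *)
have even_neg (x : R) : 0 < x ->
  (x - a) * (x - b) * (x - c) * ((u + x) * (v + x))
  < (a + x) * (b + x) * (c + x) * ((u - x) * (v - x)).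
  move=> x0; rewrite -subr_gt0.
  have -> : (a + x) * (b + x) * (c + x) * ((u - x) * (v - x)) -
    (x - a) * (x - b) * (x - c) * ((u + x) * (v + x)) =
    2 * ((a + b + c - (u + v)) * x ^+ 4 +
     ((a + b + c) * (u * v) + a * b * c
       - (a * b + a * c + b * c) * (u + v)) * x ^+ 2
     + a * b * c * (u * v)) by ring.
  by rewrite mulr_gt0 // !addr_gt0 ?mulr_gt0 ?exprn_gt0 ?subr_gt0.
have at_pos (x : R) : 0 < x -> (x - a) * (x - b) * (x - c) = 0 ->
    0 < (u - x) * (v - x).
  move=> x0 x_eq; have := even_neg _ x0; rewrite x_eq mul0r pmulr_rgt0 //.
  by rewrite !mulr_gt0 ?addr_gt0.
have at_neg : (u - a) * (u - b) * (u - c) < 0.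
  have := even_neg _ u0; rewrite subrr mul0r mulr0 pmulr_llt0 //.
  by rewrite !mulr_gt0 ?addr_gt0.
have ua : a < u.
  rewrite ltNge; apply/negP => ua.
  have {ua}ua : u < a.
    rewrite lt_neqAle ua andbT; apply/eqP => uE.
    by move: at_neg; rewrite uE subrr !mul0r ltxx.
  have va : v < a.
    have := at_pos a a0; rewrite subrr !mul0r => /(_ erefl).
    by rewrite nmulr_rgt0 ?subr_lt0.
  have inv_gt (x y : R) : 0 < x -> x < y -> y^-1 < x^-1.
    by move=> x0 xy; rewrite ltf_pV2 ?posrE // (lt_trans x0).
  (* The degree 1 coefficient bounds the sum of 1/u and 1/v; the degree 2 one
     contradicts the resulting inequality. *)
  have := @reciprocal_ineq R a^-1 b^-1 c^-1 u^-1 v^-1.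
  rewrite invr_gt0 c0 !inv_gt // => /(_ isT isT isT isT isT).
  have -> : u^-1 + v^-1 = (u + v) / (u * v).
    by field; rewrite !gt_eqF.
  have -> : a^-1 + b^-1 + c^-1 = (a * b + a * c + b * c) / (a * b * c).
    by field; rewrite !gt_eqF.
  rewrite ltr_pdivrMr ?mulr_gt0 // mulrAC ltr_pdivlMr ?mulr_gt0 //.
  rewrite (mulrC (u + v)) => /(_ h1').
  apply/negP; rewrite -leNgt -subr_ge0.
  have -> : u^-1 * v^-1 + (a^-1 * b^-1 + a^-1 * c^-1 + b^-1 * c^-1) -
   (a * b + a * c + b * c) / (a * b * c) * ((u + v) / (u * v)) =
   ((a + b + c) * (u * v) + a * b * c
       - (a * b + a * c + b * c) * (u + v)) / (a * b * c * (u * v)).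
    by field; rewrite !gt_eqF.
  by rewrite divr_ge0 ?mulr_ge0 ?subr_ge0 // ltW.
move: at_neg; rewrite -mulrA pmulr_rlt0 ?subr_gt0 // => bcu.
by apply/andP; split; rewrite ltNge; apply/negP => ?; nra.
Qed.

(** * Number of positive roots *)

(** If q(x) = q(y) = 0 then q(y) x^m - q(x) y^m = 0; but in this difference the
terms of degree m cancel and, since x < y, all the others are positive. *)
Lemma no_two_pos_roots (R : realType) (m : nat) (q : {poly R}) (x y : R) :
  (0 < m)%N -> (size q <= m.+1)%N -> (forall i, (i < m)%N -> q`_i < 0) ->
  0 < x -> x < y -> root q x -> root q y -> False.
Proof.
move=> m0 sq qneg x0 xy /rootP qx /rootP qy.
have y0 := lt_trans x0 xy.
pose t (i : 'I_m) :=
  - q`_i * ((x * y) ^+ i * (y ^+ (m - i) - x ^+ (m - i))).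
have tpos i : 0 < t i.
  rewrite mulr_gt0 ?oppr_gt0 ?qneg // mulr_gt0 ?exprn_gt0 ?mulr_gt0 //.
  by rewrite subr_gt0 ltrXn2r ?ltW // subn_eq0 -ltnNge.
have : \sum_i t i = 0.
  have -> : \sum_i t i = q.[y] * x ^+ m - q.[x] * y ^+ m.
    rewrite !(horner_coef_wide _ sq) !mulr_suml -sumrB big_ord_recr /=.
    rewrite -!mulrA [y ^+ m * _]mulrC subrr addr0; apply: eq_bigr => i _.
    rewrite /t -[in y ^+ m](subnKC (ltnW (ltn_ord i))).
    rewrite -[in x ^+ m](subnKC (ltnW (ltn_ord i))) !exprD exprMn; ring.
  by rewrite qx qy !mul0r subrr.
move/(psumr_eq0P (fun i _ => ltW (tpos i)))/(_ (Ordinal m0) isT) => t0.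
by have := tpos (Ordinal m0); rewrite t0 ltxx.
Qed.

Lemma rolle_root (R : realType) (p : {poly R}) (x y : R) :
  x < y -> root p x -> root p y -> exists2 z, x < z < y & root p^`() z.
Proof.
move=> xy /rootP px /rootP py.
have [z z_in pz] := poly_rolle xy (etrans px (esym py)).
by exists z; [move: z_in; rewrite in_itv | apply/rootP].
Qed.

(** Rolle's theorem, applied twice, reduces this to two positive roots of the
second derivative. *)
Lemma no_four_pos_roots (R : realType) (d : nat) (p : {poly R}) (w x y z : R) :
  (2 < d)%N -> (size p <= d.+1)%N -> (forall i, (1 < i < d)%N -> p`_i < 0) ->
  0 < w -> w < x -> x < y -> y < z ->
  root p w -> root p x -> root p y -> root p z -> False.
Proof.
move=> d2 sp pneg w0 wx xy yz pw px py pz.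
have [r1 /andP[wr1 r1x] pr1] := rolle_root wx pw px.
have [r2 /andP[xr2 r2y] pr2] := rolle_root xy px py.
have [r3 /andP[yr3 r3z] pr3] := rolle_root yz py pz.
have [s1 /andP[rs1 sr1] ps1] := rolle_root (lt_trans r1x xr2) pr1 pr2.
have [s2 /andP[rs2 sr2] ps2] := rolle_root (lt_trans r2y yr3) pr2 pr3.
have dE i : p^`()^`()`_i = p`_i.+2 *+ i.+2 *+ i.+1 by rewrite !coef_deriv.
apply: (@no_two_pos_roots R (d - 2) p^`()^`() s1 s2) ps1 ps2;
  rewrite ?subn_gt0 //.
- apply/leq_sizeP => j dj; rewrite dE.
  have jd : (d.+1 <= j.+2)%N by clear -d2 dj; lia.
  by rewrite (nth_default 0 (leq_trans sp jd)) !mul0rn.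
- move=> i id; have id2 : (1 < i.+2 < d)%N by clear -id; lia.
  by rewrite dE !pmulrn_llt0 ?pneg.
- exact: lt_trans (lt_trans w0 wr1) rs1.
- exact: lt_trans sr1 rs2.
Qed.

(** * The sign pattern *)

Lemma canonical_word_Sigma (n : nat) :
  canonical_word (Sigma [:: 1; n.+1; 1; 1]%N) =
    [:: Pos; Pos] ++ nseq n Neg ++ [:: Pos].
Proof.
rewrite /canonical_word /Sigma /= !opprK.
have cppE k (s : seq int) :
    pairmap (fun x y => if x == y then Preservation else Change) (-1)
      (nseq k (-1) ++ 1 :: s) =
    nseq k Preservation ++
      pairmap (fun x y => if x == y then Preservation else Change) (-1) (1 :: s).
  by elim: k => //= k ->.
by rewrite cppE /= rev_cons rev_cat -cats1 /= rev_nseq map_cat map_nseq.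
Qed.

Lemma sign_pattern_Sigma (R : realType) (n : nat) (P : {poly R}) :
  realizes P (Sigma [:: 1; n.+1; 1; 1]%N) ->
  [/\ size P = n.+4, low_signs P & forall i, (1 < i < n.+3)%N -> P`_i < 0].
Proof.
rewrite /realizes /sign_pattern /Sigma /= !opprK map_rev => /(canRL revK) sE.
have {}sE : [seq sgz a | a <- P] = [:: -1, 1 & nseq n.+1 (-1) ++ [:: 1]].
  rewrite sE; apply: (can_inj revK); rewrite revK.
  by rewrite 2!rev_cons rev_cat rev_nseq -!cats1 /= -catA.
have sP : size P = n.+4.
  by rewrite -(size_map (@sgz R)) sE /= size_cat size_nseq addn1.
have PE i : (i < n.+4)%N ->
    sgz P`_i = nth 0 [:: -1, 1 & nseq n.+1 (-1) ++ [:: 1]] i.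
  by move=> i_lt; rewrite -sE (nth_map 0) // sP.
have Pneg i : (1 < i < n.+3)%N -> P`_i < 0.
  case: i => [|[|i]] //= i_lt; rewrite -sgz_lt0 PE; last exact: ltnW.
  rewrite -[nth _ _ _]/(nth 0 (nseq n.+1 (-1) ++ [:: 1]) i).
  by rewrite nth_cat size_nseq nth_nseq (i_lt : (i < n.+1)%N).
split=> //; split; last exact: Pneg.
- by rewrite -sgz_lt0 PE.
- by rewrite -sgz_gt0 PE.
Qed.

(** * Position of the negative roots *)

(** Cancelling all the negative roots but z and one other, v, leaves a
polynomial whose roots are z, v and the positive roots ps. The sign of its constant
coefficient excludes zero and two positive roots, [one_pos_two_neg_low_signs]
excludes one, and three is the case of the quintic. *)
Lemma modulus_bounds (R : realType) (n : nat) (P : {poly R}) (rs : seq R)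
    (z : R) :
  (1 < n)%N -> size P = n.+4 -> low_signs P ->
  (forall i, (1 < i < n.+3)%N -> P`_i < 0) -> roots_by_modulus P rs ->
  z \in rs -> z < 0 ->
  exists a b c, [/\ [/\ a \in rs, b \in rs & c \in rs],
                   0 < a, a < b, b < - z & - z < c].
Proof.
move=> n1 sP Plow Pneg [PE Ppath] z_rs z0.
have srs : size rs = n.+3.
  by apply: succn_inj; rewrite -sP PE size_prod_XsubC.
have sum_pos : 0 < \sum_(x <- rs) x.
  have := coefPn_prod_XsubC (ps := rs); rewrite -PE srs => /(_ isT) /= cE.
  by rewrite -oppr_lt0 -cE Pneg // ltnSn.
have rootE x : x \in rs -> root P x by rewrite PE root_prod_XsubC.
have rs_neq0 x : x \in rs -> x != 0.
  move=> x_rs; have /allP := order_path_min lt_trans Ppath.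
  by move=> /(_ _ (map_f _ x_rs)); rewrite normr_gt0.
pose ps : seq R := [seq x <- rs | 0 < x].
pose ns : seq R := [seq x <- rs | ~~ (0 < x)].
have prs : perm_eq rs (ns ++ ps).
  by rewrite perm_sym perm_catC; apply/permPl/perm_filterC.
have ns0 : all (< 0) ns.
  apply/allP => x; rewrite mem_filter -leNgt => /andP[x0 /rs_neq0 xn0].
  by rewrite /= lt_neqAle xn0.
have ps0 : {in ps, forall x, 0 < x} by move=> x; rewrite mem_filter => /andP[].
have ps_rs : {subset ps <= rs} by move=> x; rewrite mem_filter => /andP[].
have ps_sorted : sorted <%R ps.
  have : sorted <%R [seq `|x| | x <- ps].
    rewrite sorted_map; apply: sorted_filter.
      by move=> ? ? ?; apply: lt_trans.
    by rewrite -sorted_map; apply: path_sorted Ppath.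
  by rewrite (_ : map _ _ = ps) // map_id_in // => x /ps0 /ltW /ger0_norm.
have sps : (size ps < 4)%N.
  case E : ps ps_sorted => [|w [|x [|y [|t s]]]] //= /and4P[wx xy yt _].
  have t_in i : (i < 4)%N -> root P (nth 0 ps i) /\ 0 < nth 0 ps i.
    move=> i4; have i_in : nth 0 ps i \in ps.
      by rewrite mem_nth // E (leq_trans i4).
    by split; [apply/rootE/ps_rs | apply: ps0].
  have [[rw w0] [rx _] [ry _] [rt _]] :=
    And4 (t_in 0 isT) (t_in 1 isT) (t_in 2 isT) (t_in 3 isT).
  rewrite E /= in rw rx ry rt w0.
  by case: (@no_four_pos_roots R n.+3 P w x y t); rewrite ?sP.
have z_ns : z \in ns by rewrite mem_filter z_rs -leNgt ltW.
have [v [ms pns]] : exists v ms, perm_eq ns (ms ++ [:: z; v]).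
  have sns : (1 < size ns)%N.
    move: (perm_size prs) sps n1; rewrite size_cat srs.
    by move: (size ns) (size ps) => k l; clear; lia.
  have := perm_to_rem z_ns; case: (rem z ns) => [|v ms] pns.
    by rewrite (perm_size pns) in sns.
  by exists v, ms; rewrite (perm_trans pns) // perm_sym perm_catC.
have {}prs : perm_eq rs (ms ++ [:: z, v & ps]).
  rewrite (perm_trans prs) // -[_ :: _ :: _]/([:: z; v] ++ ps) catA.
  by rewrite perm_cat2r.
move: ns0; rewrite (perm_all _ pns) all_cat => /and3P[ms0 _ /andP[/= v0 _]].
have qlow : low_signs (\prod_(x <- [:: z, v & ps]) ('X - x%:P)).
  by apply: (low_signs_prod_cancel_neg ms0); rewrite -(perm_big _ prs) -PE.
have qsum : 0 < \sum_(x <- [:: z, v & ps]) x.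
  apply: lt_le_trans sum_pos _; rewrite (perm_big _ prs) big_cat gerDr.
  by rewrite big_seq sumr_le0 // => x /(allP ms0) /ltW.
have zv : 0 < z * v by rewrite nmulr_rgt0.
case E : ps qlow qsum ps0 ps_sorted sps =>
  [|a [|b [|c [|e s]]]] // qlow qsum ps0 ps_sorted _.
- case: qlow; rewrite !big_cons big_nil !coef0_XsubC_mul coef1 /= => + _ _.
  by rewrite mulr1 mulrN opprK ltNge ltW.
- have a0 : 0 < a by apply: ps0; rewrite mem_head.
  by case: (one_pos_two_neg_low_signs a0 z0 v0 qlow).
- have a0 : 0 < a by apply: ps0; rewrite mem_head.
  have b0 : 0 < b by apply: ps0; rewrite !inE eqxx orbT.
  case: qlow; rewrite !big_cons big_nil !coef0_XsubC_mul coef1 /= => + _ _.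
  have zvab := mulr_gt0 (mulr_gt0 zv a0) b0.
  by rewrite mulr1 !mulrN !opprK !mulrA ltNge ltW.
have a0 : 0 < a by apply: ps0; rewrite mem_head.
case/and3P: ps_sorted => ab bc _.
rewrite -[z]opprK -[v]opprK in qlow.
have /andP[bz zc] : b < - z < c.
  apply: quintic_neg_moduli a0 ab bc _ _ _ qlow; rewrite ?oppr_gt0 //.
  by move: qsum; rewrite !big_cons big_nil; lra.
by exists a, b, c; split=> //; split; apply: ps_rs; rewrite E !inE eqxx ?orbT.
Qed.

(** A negative root has two positive roots before it and one after it in the
list by modulus, so the first two roots and the last one are positive. Any other
positive root would be a fourth one. *)
Lemma canonical_order_of_signs (R : realType) (n : nat) (P : {poly R})
    (rs : seq R) :
  (1 < n)%N -> size P = n.+4 -> low_signs P ->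
  (forall i, (1 < i < n.+3)%N -> P`_i < 0) -> roots_by_modulus P rs ->
  canonical_order (Sigma [:: 1; n.+1; 1; 1]%N) rs.
Proof.
move=> n1 sP Plow Pneg Prs.
have bounds := modulus_bounds n1 sP Plow Pneg Prs.
case: Prs => PE Ppath.
have srs : size rs = n.+3.
  by apply: succn_inj; rewrite -sP PE size_prod_XsubC.
have rootE i : (i < n.+3)%N -> root P rs`_i.
  by move=> i_lt; rewrite PE root_prod_XsubC mem_nth ?srs.
have neq0 i : (i < n.+3)%N -> rs`_i != 0.
  move=> i_lt; have /allP := order_path_min lt_trans Ppath.
  have i_in : rs`_i \in rs by rewrite mem_nth ?srs.
  by move=> /(_ _ (map_f _ i_in)); rewrite normr_gt0.
have ltE i j : (i < n.+3)%N -> (j < n.+3)%N ->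
    (`|rs`_i| < `|rs`_j|) = (i < j)%N.
  move=> i_lt j_lt.
  have := lt_sorted_ltn_nth 0 (path_sorted Ppath).
  move=> /(_ i j); rewrite !inE size_map srs => /(_ i_lt j_lt) <-.
  by rewrite !(nth_map 0) ?srs.
have neg_between i : (i < n.+3)%N -> rs`_i < 0 -> (1 < i < n.+2)%N.
  move=> i_lt i0.
  have [|a [b [c [[]]]]] := bounds _ _ i0; first by rewrite mem_nth ?srs.
  move=> /(nthP 0)[ia + <-] /(nthP 0)[ib + <-] /(nthP 0)[ic + <-].
  rewrite srs => ia_lt ib_lt ic_lt a0 ab bi ic0.
  have b0 := lt_trans a0 ab; have c0 := lt_trans b0 (lt_trans bi ic0).
  have {}ab : (ia < ib)%N by rewrite -ltE // !gtr0_norm.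
  have {}bi : (ib < i)%N by rewrite -ltE // gtr0_norm // ltr0_norm.
  have {}ic0 : (i < ic)%N by rewrite -ltE // ltr0_norm // gtr0_norm.
  by clear -ab bi ic0 ic_lt; lia.
have pos i : (i < n.+3)%N -> ~~ (1 < i < n.+2)%N -> 0 < rs`_i.
  move=> i_lt; rewrite lt0r neq0 //= leNgt; exact/contra/neg_between.
have pos_lt i j : (i < j)%N -> (j < n.+3)%N -> 0 < rs`_i -> 0 < rs`_j ->
    rs`_i < rs`_j.
  move=> ij j_lt i0 j0; rewrite -(gtr0_norm i0) -(gtr0_norm j0) ltE //.
  exact: ltn_trans j_lt.
move=> i; rewrite srs canonical_word_Sigma => i_lt.
have [i_mid|i_ext] := boolP (1 < i < n.+2)%N; last first.
  have := pos i i_lt i_ext.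
  case: i i_lt i_ext => [|[|i]] //= i_lt i_ext.
  have -> : i = n by clear -i_lt i_ext; lia.
  by rewrite nth_cat size_nseq ltnn subnn.
have -> : nth Neg ([:: Pos; Pos] ++ nseq n Neg ++ [:: Pos]) i = Neg.
  case: i i_lt i_mid => [|[|i]] //= _; rewrite !ltnS => i_n.
  by rewrite nth_cat size_nseq i_n nth_nseq i_n.
have [i_gt1 i_ltn] := andP i_mid.
rewrite ltNge; apply/negP.
rewrite le_eqVlt eq_sym (negPf (neq0 _ i_lt)) /= => i0.
have p0 := pos 0%N isT isT; have p1 := pos 1%N isT isT.
have p2 : 0 < rs`_n.+2 by apply: pos => //; rewrite ltnn andbF.
by apply: (@no_four_pos_roots R n.+3 P rs`_0 rs`_1 rs`_i rs`_n.+2);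
  rewrite ?sP ?rootE ?pos_lt.
Qed.

End SigmaCanonical.

Theorem proposition3 (R : realType) (d : nat) (hd : 5 <= d) :
  canonical R (Sigma [:: 1; d - 2; 1; 1]).
Proof.
move=> P rs _ Psigma Prs.
have dE : (d - 2 = (d - 3).+1)%N by lia.
rewrite dE in Psigma *.
have [sP Plow Pneg] := sign_pattern_Sigma Psigma.
apply: canonical_order_of_signs sP Plow Pneg Prs.
by lia.
Qed.
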